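(* Let $\mathcal V$ be a variety that has a Taylor term. The following are equivalent: \begin{enumerate} \item[(1)] $\mathcal V$ has a weak difference term. \item[(2)] $\mathcal V$ has a term $w(x,y,z)$ such that whenever $\mathbf A\in\mathcal V$, $T$ is an abelian tolerance on $\mathbf A$, and $(a,b)\in T$, then $w^{\mathbf A}(a,a,b)=b=w^{\mathbf A}(b,a,a)$. \item[(3)] In any algebra of $\mathcal V$, any abelian tolerance is a congruence. \item[(4)] In any algebra of $\mathcal V$, the congruence generated by an abelian tolerance is abelian. \end{enumerate}
   Context: A tolerance on an algebra $\mathbf A$ is a reflexive, symmetric, compatible binary relation on $A$ (a reflexive symmetric subuniverse of $\mathbf A^2$); congruences are transitive tolerances. For tolerances $S,T$ and a congruence $\delta$ of $\mathbf A$, the centralizer relation $\mathrm{C}(S,T;\delta)$ holds if for every term $t(x,y_1,\dots,y_n)$ of $\mathbf A$, every $(a,b)\in S$ and all $(c_i,d_i)\in T$ ($1\le i\le n$), $t(a,\bar c)\mathrel{\delta} t(a,\bar d)$ implies $t(b,\bar c)\mathrel{\delta} t(b,\bar d)$. A tolerance (or congruence) $T$ is abelian if $\mathrm{C}(T,T;0)$ holds, where $0$ is the equality relation. A Taylor term for $\mathcal V$ is a term $T(x_1,\dots,x_n)$ such that $\mathcal V\models T(x,\dots,x)\approx x$ and for each $i$, $\mathcal V$ satisfies some identity $T(\bar w)\approx T(\bar z)$ where $\bar w,\bar z$ are tuples of variables with $w_i\neq z_i$. A weak difference term for $\mathcal V$ is a term $w(x,y,z)$ such that for every $\mathbf B\in\mathcal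 V$, $w^{\mathbf B}(a,a,b)=b=w^{\mathbf B}(b,a,a)$ whenever $(a,b)$ lies in an abelian congruence of $\mathbf B$. *)

(* Defs.v *)
From mathcomp Require Import all_boot.
Set Implicit Arguments. Unset Strict Implicit. Unset Printing Implicit Defensive.

Record signature := Signature { op : Type; arity : op -> nat }.

Inductive term (S : signature) (X : Type) : Type :=
| Var : X -> term S X
| App : forall f : op S, ('I_(arity f) -> term S X) -> term S X.
Arguments Var {S X} x.
Arguments App {S X} f args.

Record algebra (S : signature) := Algebra {
  carrier :> Type;
  interp : forall f : op S, ('I_(arity f) -> carrier) -> carrier }.

Fixpoint eval (S : signature) (A : algebra S) (X : Type) (t : term S X)
  (v : X -> A) : A :=
  match t with
  | Var x => v x
  | App f args => @interp S A f (fun i => @eval S A X (args i) v)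
  end.
Arguments eval {S} A {X} t v.

(* A variety, given by a set Sigma of identities s ≈ t over variables nat
   (Birkhoff: varieties = equational classes). *)
Definition identities (S : signature) := term S nat -> term S nat -> Prop.

Definition in_variety (S : signature) (Sigma : identities S) (A : algebra S) : Prop :=
  forall s t, Sigma s t -> forall v : nat -> A, eval A s v = eval A t v.

Definition compatible (S : signature) (A : algebra S) (R : A -> A -> Prop) : Prop :=
  forall (f : op S) (a b : 'I_(arity f) -> A),
    (forall i, R (a i) (b i)) -> R (@interp S A f a) (@interp S A f b).

Definition tolerance (S : signature) (A : algebra S) (R : A -> A -> Prop) : Prop :=
  [/\ (forall x, R x x), (forall x y, R x y -> R y x) & compatible R].

Definition congruence (S : signature) (A : algebra S) (R : A -> A -> Prop) : Prop :=
  tolerance R /\ (forall x y z, R x y -> R y z -> R x z).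

Definition xval (A : Type) (n : nat) (a : A) (c : 'I_n -> A) : option 'I_n -> A :=
  fun o => match o with None => a | Some i => c i end.

Definition centralizes (S : signature) (A : algebra S)
  (Sr Tr delta : A -> A -> Prop) : Prop :=
  forall (n : nat) (t : term S (option 'I_n)) (a b : A) (c d : 'I_n -> A),
    Sr a b -> (forall i, Tr (c i) (d i)) ->
    delta (eval A t (xval a c)) (eval A t (xval a d)) ->
    delta (eval A t (xval b c)) (eval A t (xval b d)).

Definition abelian (S : signature) (A : algebra S) (R : A -> A -> Prop) : Prop :=
  centralizes R R (@eq A).

Definition Cg (S : signature) (A : algebra S) (R : A -> A -> Prop) : A -> A -> Prop :=
  fun x y => forall theta : A -> A -> Prop,
      congruence theta -> (forall u v, R u v -> theta u v) -> theta x y.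

Definition val3 (A : Type) (x y z : A) : 'I_3 -> A :=
  fun i => match val i with 0 => x | 1 => y | _ => z end.

Definition has_taylor_term (S : signature) (Sigma : identities S) : Prop :=
  exists (n : nat) (t : term S 'I_n),
    (forall A : algebra S, in_variety Sigma A ->
       forall a : A, eval A t (fun _ => a) = a) /\
    (forall i : 'I_n, exists w z : 'I_n -> nat, w i <> z i /\
       forall A : algebra S, in_variety Sigma A ->
         forall v : nat -> A, eval A t (fun j => v (w j)) = eval A t (fun j => v (z j))).

Definition weak_difference_term (S : signature) (Sigma : identities S)
  (w : term S 'I_3) : Prop :=
  forall B : algebra S, in_variety Sigma B ->
    forall theta : B -> B -> Prop, congruence theta -> abelian theta ->
      forall a b : B, theta a b ->
        eval B w (val3 a a b) = b /\ eval B w (val3 b a a) = b.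

Definition cond1 (S : signature) (Sigma : identities S) : Prop :=
  exists w : term S 'I_3, weak_difference_term Sigma w.

Definition cond2 (S : signature) (Sigma : identities S) : Prop :=
  exists w : term S 'I_3,
    forall A : algebra S, in_variety Sigma A ->
      forall T : A -> A -> Prop, tolerance T -> abelian T ->
        forall a b : A, T a b ->
          eval A w (val3 a a b) = b /\ eval A w (val3 b a a) = b.

Definition cond3 (S : signature) (Sigma : identities S) : Prop :=
  forall A : algebra S, in_variety Sigma A ->
    forall T : A -> A -> Prop, tolerance T -> abelian T -> congruence T.

Definition cond4 (S : signature) (Sigma : identities S) : Prop :=
  forall A : algebra S, in_variety Sigma A ->
    forall T : A -> A -> Prop, tolerance T -> abelian T -> abelian (Cg T).

(* Main.v *)
Require Import Defs.
From mathcomp Require Import all_boot.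
From Stdlib Require Import FunctionalExtensionality PropExtensionality.
From Stdlib Require Import IndefiniteDescription ProofIrrelevance.
Set Implicit Arguments. Unset Strict Implicit. Unset Printing Implicit Defensive.

(** (2) => (3) holds since w(x,y,y) = x and w(y,y,z) = z are T-related when x T y T z, and
    (3) => (4) is immediate.

    (1) => (2).  Let (a,b) lie in an abelian tolerance T of A.  On binary terms let theta
    relate p and q when p(x,x) = q(x,x) holds in the variety.  The values at (a,b) of the
    idempotent terms are pairwise T-related, and on them a Taylor term turns the term
    condition for T into the one for theta, although theta is only the transitive closure
    of T.  Two terms are identified when no polynomial into the class of idempotent terms
    separates their values at (a,b); modulo this congruence theta is abelian, so a weak
    difference term works there, and nothing is lost on idempotent terms.

    (4) => (1).  Let F be generated by pairs (x,u), (z,u), (x,v), (z,v), each coordinate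
    being generic for an abelian congruence, and glue (x,u) to (z,u).  "Equal first
    coordinates, related second coordinates" induces a tolerance on the quotient which is
    abelian because the second coordinate survives the gluing.  If the congruence it
    generates is abelian, a Taylor term forces (x,v) = (z,v) in the quotient.  But over v
    the gluing only identifies e with t(z,x,e) for terms t satisfying t(x,x,y) = y on
    abelian congruences, hence t(z,x,x) = z for such a t, a weak difference term. *)

(** * Terms, substitution and finite support *)

Definition term_alg (S : signature) (X : Type) : algebra S :=
  Algebra (@App S X).

Lemma eval_subst (S : signature) (A : algebra S) (X Y : Type) (t : term S X)
    (s : X -> term S Y) (v : Y -> A) :
  eval A (eval (term_alg S Y) t s) v = eval A t (fun x => eval A (s x) v).
Proof.
elim: t => [x|f args IH] //=.
by congr interp; apply: functional_extensionality => i; exact: IH.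
Qed.

Lemma eval_compatible (S : signature) (A : algebra S) (R : A -> A -> Prop)
    (X : Type) (t : term S X) (v w : X -> A) :
  compatible R -> (forall x, R (v x) (w x)) -> R (eval A t v) (eval A t w).
Proof. by move=> cR vw; elim: t => [x|f args IH] //=; exact: cR. Qed.

Lemma eval_ext (S : signature) (A : algebra S) (X : Type) (t : term S X)
    (v w : X -> A) : (forall x, v x = w x) -> eval A t v = eval A t w.
Proof. by move=> vw; congr eval; apply: functional_extensionality. Qed.

(** The term condition only speaks of finitely many variables. Arities are finite, so the variables
    of all arguments can be numbered jointly, through the tagged sum of their index types. *)
Lemma finite_support (S : signature) (X : Type) (t : term S X) :
  exists (n : nat) (t' : term S 'I_n) (e : 'I_n -> X),
    forall (A : algebra S) (v : X -> A), eval A t v = eval A t' (fun i => v (e i)).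
Proof.
elim: t => [x|f args IH].
  by exists 1, (Var ord0), (fun=> x).
have H i : exists p : {n & (term S 'I_n * ('I_n -> X))%type},
    forall (A : algebra S) (v : X -> A),
      eval A (args i) v = eval A (projT2 p).1 (fun j => v ((projT2 p).2 j)).
  by have [n [t' [e He]]] := IH i; exists (existT _ n (t', e)).
have [F HF] := functional_choice _ H.
pose I : finType := {i : 'I_(arity f) & 'I_(projT1 (F i))}.
pose g i (j : 'I_(projT1 (F i))) : 'I_#|I| := enum_rank (Tagged (fun i => 'I_(projT1 (F i))) j).
exists #|I|, (App f (fun i => eval (term_alg S 'I_#|I|) (projT2 (F i)).1 (fun j => Var (g i j)))).
exists (fun k => let x := enum_val k in (projT2 (F (tag x))).2 (tagged x)) => A v /=.
congr interp; apply: functional_extensionality => i; rewrite HF eval_subst /=.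
by apply: eval_ext => j; rewrite /g enum_rankK.
Qed.

(** * Changing a tuple one entry at a time *)

Definition upd (n : nat) (A : Type) (c : 'I_n -> A) (k : 'I_n) (x : A) : 'I_n -> A :=
  fun i => if i == k then x else c i.

Lemma upd_id (n : nat) (A : Type) (c : 'I_n -> A) (k : 'I_n) : upd c k (c k) = c.
Proof.
by apply: functional_extensionality => i; rewrite /upd; case: eqP => // ->.
Qed.

Lemma upd_const (n : nat) (A : Type) (k : 'I_n) (x : A) : upd (fun=> x) k x = (fun=> x).
Proof. exact: (upd_id (fun=> x)). Qed.

Lemma fun_upd (n : nat) (A B : Type) (f : A -> B) (c : 'I_n -> A) (k : 'I_n) (x : A) :
  (fun i => f (upd c k x i)) = upd (fun i => f (c i)) k (f x).
Proof. by apply: functional_extensionality => i; rewrite /upd; case: eqP. Qed.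

Lemma eval_subst_upd (S : signature) (B : algebra S) (X : Type) (n : nat) (t : term S 'I_n)
    (c : 'I_n -> term_alg S X) (k : 'I_n) (x : term_alg S X) (v : X -> B) :
  eval B (eval (term_alg S X) t (upd c k x)) v =
  eval B t (upd (fun i => eval B (c i) v) k (eval B x v)).
Proof. by rewrite eval_subst (fun_upd (fun t => eval B t v)). Qed.

Lemma upd_upd_const (n : nat) (A : Type) (i j : 'I_n) (x y : A) :
  j != i -> upd (upd (fun=> x) i y) j x = upd (fun=> x) i y.
Proof.
move=> ne; apply: functional_extensionality => k; rewrite /upd.
by case: (k =P j) => // ->; rewrite (negbTE ne).
Qed.

Lemma change_one_by_one (n : nat) (A : Type) (a b : 'I_n -> A)
    (Q : ('I_n -> A) -> Prop) :
  Q a ->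
  (forall (c : 'I_n -> A) (k : 'I_n), (forall i, c i = a i \/ c i = b i) ->
     c k = a k -> Q c -> Q (upd c k (b k))) ->
  Q b.
Proof.
move=> Qa step.
have H : forall m, m <= n -> Q (fun i : 'I_n => if i < m then b i else a i).
  elim=> [_|m IH lt_mn]; first exact: Qa.
  have := step _ (Ordinal lt_mn) _ _ (IH (ltnW lt_mn)).
  rewrite /= ltnn; set Q1 := Q _; set Q2 := Q _.
  have -> : Q1 = Q2; last by apply=> // i; case: ifP; [right | left].
  congr Q; apply: functional_extensionality => i; rewrite /upd ltnS (leq_eqVlt i m).
  have [->|ne] := eqVneq i (Ordinal lt_mn); first by rewrite /= eqxx.
  by rewrite (inj_eq val_inj i (Ordinal lt_mn) : (i == m :> nat) = _) (negbTE ne).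
move: (H n (leqnn n)); congr Q; apply: functional_extensionality => i.
by rewrite ltn_ord.
Qed.

(** * Matrices and the term condition *)

(* [Mat T U a b c d] says that the matrix with rows (a,b) and (c,d) lies in M(T,U). *)
Inductive Mat (S : signature) (A : algebra S) (T U : A -> A -> Prop) :
  A -> A -> A -> A -> Prop :=
| Mat_left a b : T a b -> Mat T U a a b b
| Mat_right a b : U a b -> Mat T U a b a b
| Mat_op (f : op S) (a b c d : 'I_(arity f) -> A) :
    (forall i, Mat T U (a i) (b i) (c i) (d i)) ->
    Mat T U (@interp S A f a) (@interp S A f b) (@interp S A f c) (@interp S A f d).

Lemma Mat_eval (S : signature) (A : algebra S) (T U : A -> A -> Prop) (X : Type)
    (t : term S X) (a b c d : X -> A) :
  (forall x, Mat T U (a x) (b x) (c x) (d x)) ->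
  Mat T U (eval A t a) (eval A t b) (eval A t c) (eval A t d).
Proof. by move=> H; elim: t => [x|f args IH] //=; apply: Mat_op. Qed.

(** Taking the generating matrices themselves as variables turns closure under the operations into a
    single term; [finite_support] then keeps finitely many of them. *)
Lemma Mat_term (S : signature) (A : algebra S) (T U : A -> A -> Prop) (a b c d : A) :
  Mat T U a b c d ->
  exists (n : nat) (t : term S 'I_n) (v : bool -> bool -> 'I_n -> A),
    [/\ a = eval A t (v false false), b = eval A t (v false true),
        c = eval A t (v true false), d = eval A t (v true true) &
        forall i, (forall x, v x false i = v x true i) /\ T (v false false i) (v true false i)
          \/ (forall x, v false x i = v true x i) /\ U (v false false i) (v false true i)].
Proof.
pose X := ({p : A * A | T p.1 p.2} + {p : A * A | U p.1 p.2})%type.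
pose w x y (z : X) := match z with
  | inl p => if x then (sval p).2 else (sval p).1
  | inr p => if y then (sval p).2 else (sval p).1 end.
move=> M.
have [t [-> -> -> ->]] : exists t : term S X,
    [/\ a = eval A t (w false false), b = eval A t (w false true),
        c = eval A t (w true false) & d = eval A t (w true true)].
  elim: M => {a b c d} [a b Tab|a b Uab|f a b c d _ IH].
  - by exists (Var (inl (exist _ (a, b) Tab))).
  - by exists (Var (inr (exist _ (a, b) Uab))).
  have [g Hg] := functional_choice _ IH.
  by exists (App f g); split=> /=; congr interp; apply: functional_extensionality => i;
    case: (Hg i).
have [n [t' [e He]]] := finite_support t.
exists n, t', (fun x y i => w x y (e i)); rewrite !He; split=> // i.
by case: (e i) => [[p Tp]|[p Up]]; [left | right].
Qed.

(** [centralizes] moves one variable along [T], whereas a matrix may move many. They are switched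
    from the first row to the second one at a time; [r] records which have been switched. *)
Lemma centralizes_Mat (S : signature) (A : algebra S) (T U delta : A -> A -> Prop)
    (a b c d : A) :
  (forall x, U x x) -> centralizes T U delta -> Mat T U a b c d ->
  delta a b -> delta c d.
Proof.
move=> reflU C /Mat_term [n [t [v [-> -> -> -> Hv]]]].
pose row r y i := v (r i) y i.
pose Q r := delta (eval A t (row r false)) (eval A t (row r true)).
move=> Qfalse; apply: (@change_one_by_one n bool (fun=> false) (fun=> true) Q) => // r k _ rk.
rewrite /Q => Qr.
(* A generator from [U] has equal rows, so switching it changes nothing. *)
have [[eqk Tk]|[eqk _]] := Hv k; last first.
  have E y : row (upd r k true) y = row r y.
    apply: functional_extensionality => i; rewrite /row /upd.
    by case: eqP => // ->; rewrite rk eqk.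
  by rewrite !E.
(* The variable being switched becomes [None], the moving argument of the term condition. *)
pose t' := eval (term_alg S (option 'I_n)) t
  (fun i => if i == k then Var None else Var (Some i)).
have Et x y r' : r' k = x -> (forall i, i != k -> r' i = r i) ->
    eval A t' (xval (v x false k) (row r y)) = eval A t (row r' y).
  move=> r'k r'i; rewrite /t' eval_subst; apply: eval_ext => i.
  case: eqP => [->|/eqP ne] /=; last by rewrite /row r'i.
  by rewrite /row r'k; case: y; rewrite -?eqk.
have Eupd y : eval A t' (xval (v true false k) (row r y)) = eval A t (row (upd r k true) y).
  by apply: Et => [|i /negbTE ne]; rewrite /upd ?eqxx ?ne.
rewrite -!Eupd; apply: (C _ _ _ _ _ _ Tk); last by rewrite !(Et _ _ r).
by move=> i; rewrite /row; have [[E _]|[E Ui]] := Hv i; [rewrite E | case: (r i); rewrite -?E].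
Qed.

(** * Polynomials, congruences and quotients *)

(** [odflt x] reads [None] as x and a parameter [Some c] as c, so [g] is a unary polynomial of A. *)
Lemma compatible_of_polynomials (S : signature) (A : algebra S) (R : A -> A -> Prop) :
  (forall x, R x x) -> (forall x y z, R x y -> R y z -> R x z) ->
  (forall (g : term S (option A)) x y, R x y ->
     R (eval A g (odflt x)) (eval A g (odflt y))) ->
  compatible R.
Proof.
move=> Rr Rt Rp f a b Rab.
apply: (change_one_by_one (a := a) (b := b) (Q := fun c => R _ (@interp S A f c))) => //.
move=> c k _ ck; move/Rt; apply.
pose g := App f (fun i => if i == k then Var None else Var (Some (c i))).
have E x : eval A g (odflt x) = @interp S A f (upd c k x).
  by rewrite /=; congr interp; apply: functional_extensionality => i; rewrite /upd; case: eqP.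
by rewrite -{1}(upd_id c k) ck -!E; apply: Rp.
Qed.

Lemma quotient_exists (S : signature) (A : algebra S) (R : A -> A -> Prop) :
  congruence R ->
  exists (Q : algebra S) (pi : A -> Q),
    [/\ forall f a, pi (@interp S A f a) = @interp S Q f (fun i => pi (a i)),
        forall x y, pi x = pi y <-> R x y & forall q, exists x, pi x = q].
Proof.
move=> [[Rr Rs Rc] Rt].
pose C := {P : A -> Prop | exists a, P = R a}.
pose pi a : C := exist _ (R a) (ex_intro _ a erefl).
have pi_surj q : exists x, pi x = q.
  by case: q => P [a e]; exists a; subst P.
have [rep repK] := functional_choice _ pi_surj.
have piP x y : pi x = pi y <-> R x y.
  split=> [/(congr1 sval) /= e|Rxy]; first by rewrite e.
  have e : R x = R y.
    apply: functional_extensionality => z; apply: propositional_extensionality.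
    by split; apply: Rt => //; apply: Rs.
  have E P (p : exists a, P = R a) : P = R y -> exist (fun P => exists a, P = R a) P p = pi y.
    by move=> eP; subst P; congr exist; exact: proof_irrelevance.
  exact: E.
exists (@Algebra S C (fun f q => pi (@interp S A f (fun i => rep (q i))))), pi.
split=> // f a /=; apply/piP; apply: Rc => i; apply/piP.
by rewrite repK.
Qed.

Lemma eval_hom (S : signature) (A Q : algebra S) (pi : A -> Q) (X : Type) (t : term S X)
    (v : X -> A) :
  (forall f a, pi (@interp S A f a) = @interp S Q f (fun i => pi (a i))) ->
  eval Q t (fun x => pi (v x)) = pi (eval A t v).
Proof.
move=> pi_hom; elim: t => [x|f args IH] //=; rewrite pi_hom.
by congr interp; apply: functional_extensionality.
Qed.

Lemma quotient_in_variety (S : signature) (Sigma : identities S) (A Q : algebra S)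
    (pi : A -> Q) :
  (forall f a, pi (@interp S A f a) = @interp S Q f (fun i => pi (a i))) ->
  (forall q, exists x, pi x = q) ->
  (forall l r, Sigma l r -> forall v : nat -> A, pi (eval A l v) = pi (eval A r v)) ->
  in_variety Sigma Q.
Proof.
move=> pi_hom pi_surj H l r lr v.
have [rep repK] := functional_choice _ pi_surj.
have -> : v = (fun n => pi (rep (v n))) by apply: functional_extensionality => n; rewrite repK.
by rewrite !(eval_hom _ _ pi_hom); exact: H.
Qed.

(** * Collapsing related elements with a Taylor term *)

Lemma exchange (S : signature) (A : algebra S) (T : A -> A -> Prop) (n : nat)
    (t : term S 'I_n) (i : 'I_n) (y c : 'I_n -> A) (r s : A) :
  tolerance T -> abelian T -> T r s -> (forall j, T (y j) (c j)) ->
  eval A t (upd y i r) = eval A t (upd y i s) ->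
  eval A t (upd c i r) = eval A t (upd c i s).
Proof.
move=> [Tr _ _] ab Trs Tyc; apply: (centralizes_Mat Tr ab); apply: Mat_eval => j.
by rewrite /upd; case: eqP => _; [apply: Mat_right | apply: Mat_left].
Qed.

(** t(r,...,r) = r is turned into t(s,...,s) = s one entry at a time. At entry k the hypothesis
    permits the change in one context [y], and [exchange] carries it over to the current context. *)
Lemma taylor_collapse (S : signature) (A : algebra S) (T : A -> A -> Prop) (n : nat)
    (t : term S 'I_n) (r s : A) :
  tolerance T -> abelian T -> (forall a : A, eval A t (fun=> a) = a) -> T r s ->
  (forall i, exists y : 'I_n -> A, (forall j, T (y j) r /\ T (y j) s) /\
     eval A t (upd y i r) = eval A t (upd y i s)) ->
  r = s.
Proof.
move=> tT ab idem Trs H; have [Tr Ts _] := tT.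
rewrite -[RHS]idem.
apply: (change_one_by_one (a := fun=> r) (b := fun=> s) (Q := fun c => r = eval A t c)).
  by rewrite idem.
move=> c k cv ck -> ; have [y [Ty e]] := H k.
rewrite -{1}(upd_id c k) ck; apply: (exchange tT ab Trs _ e) => j.
by have [Tj1 Tj2] := Ty j; case: (cv j) => ->.
Qed.

(* If p, r are the values h(u,c), h(v,c), and p, s the values h(u,d), h(v,d), where c and d
   are only connected by two T-steps, then the term condition still yields r = s. *)
Lemma collapse_two_steps (S : signature) (A : algebra S) (T : A -> A -> Prop) (n : nat)
    (t : term S 'I_n) (p r p' r' s : A) :
  tolerance T -> abelian T -> (forall a : A, eval A t (fun=> a) = a) ->
  (forall i, exists w z : 'I_n -> nat, w i <> z i /\
     forall v : nat -> A, eval A t (fun j => v (w j)) = eval A t (fun j => v (z j))) ->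
  Mat T T p r p' r' -> Mat T T p' r' p s -> T p r -> T p s -> T r s -> r = s.
Proof.
move=> tT ab idem pat M1 M2 Tpr Tps Trs; have [Tr Ts _] := tT.
apply: (taylor_collapse tT ab idem Trs) => i.
have [w [z [wz e]]] := pat i.
(* The variable w_i gets p and all others r, so entry i is p in [x] and r in [y]. *)
pose v m := if m == w i then p else r.
pose x j := v (w j); pose y j := v (z j).
have xi : x i = p by rewrite /x /v eqxx.
have yi : y i = r by rewrite /y /v; case: eqP => // zw; case: wz.
have vP m : T (v m) p /\ T (v m) r /\ T (v m) s.
  by rewrite /v; case: eqP => _; do !split=> //; apply: Ts.
have Tv m m' : T (v m) (v m') by rewrite {2}/v; case: eqP => _; case: (vP m) => ? [].
exists y; split=> [j|]; first by case: (vP (z j)) => _ [].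
rewrite -{1}yi upd_id -(e v) -/x -{1}(upd_id x i) xi.
(* The two matrices are applied in turn at entry i of t(x) = t(y): p returns to its place, while r
   has become s. *)
have E1 : eval A t (upd x i p') = eval A t (upd y i r').
  apply: (centralizes_Mat Tr ab _ (e v)); apply: Mat_eval => j; rewrite /upd.
  by case: eqP => [->|_]; [rewrite -/(x i) -/(y i) xi yi | apply: Mat_right; apply: Tv].
apply: (centralizes_Mat Tr ab _ E1); apply: Mat_eval => j; rewrite /upd.
by case: eqP => // _; apply: Mat_right; apply: Tv.
Qed.

(** * From (1) to (2) *)

(** In the quotient by [sigma] the image of [theta] is an abelian congruence, since centralizing
    modulo [sigma] becomes the term condition there. *)
Lemma weak_difference_modulo (S : signature) (Sigma : identities S) (w : term S 'I_3)
    (A : algebra S) (theta sigma : A -> A -> Prop) (a b : A) :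
  weak_difference_term Sigma w -> congruence theta -> congruence sigma ->
  (forall x y, sigma x y -> theta x y) ->
  (forall l r, Sigma l r -> forall v : nat -> A, sigma (eval A l v) (eval A r v)) ->
  centralizes theta theta sigma -> theta a b ->
  sigma (eval A w (val3 a a b)) b /\ sigma (eval A w (val3 b a a)) b.
Proof.
move=> wd [[tr ts tc] tt] csigma sub var C tab.
have [Q [pi [pi_hom piP pi_surj]]] := quotient_exists csigma.
have [rep repK] := functional_choice _ pi_surj.
have QV : in_variety Sigma Q.
  by apply: (quotient_in_variety pi_hom pi_surj) => l r lr v; apply/piP; exact: var.
pose tQ x y := theta (rep x) (rep y).
have tQP x y : theta x y -> tQ (pi x) (pi y).
  move=> txy; apply: (tt _ x); first by apply/sub/piP; rewrite repK.
  by apply: (tt _ y) => //; apply/sub/piP; rewrite repK.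
have evalQ X (t : term S X) v : eval Q t v = pi (eval A t (fun x => rep (v x))).
  by rewrite -(eval_hom _ _ pi_hom); apply: eval_ext => x; rewrite repK.
have cQ : congruence tQ.
  split; last by move=> x y z; apply: tt.
  split=> [x|x y|f x y xy]; [exact: tr | exact: ts |].
  have E z : @interp S Q f z = pi (@interp S A f (fun i => rep (z i))).
    by rewrite pi_hom; congr interp; apply: functional_extensionality => i; rewrite repK.
  by rewrite !E; apply: tQP; apply: tc.
have aQ : abelian tQ.
  move=> n t x y c d xy cd; rewrite !evalQ => /piP H; apply/piP.
  have E x' c' : (fun o => rep (@xval Q n x' c' o)) = xval (rep x') (fun i => rep (c' i)).
    by apply: functional_extensionality; case.
  by rewrite !E in H *; apply: C xy cd H.
have E x y z : eval Q w (val3 (pi x) (pi y) (pi z)) = pi (eval A w (val3 x y z)).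
  by rewrite -(eval_hom _ _ pi_hom); apply: eval_ext => -[[|[|[|]]]].
by have := wd _ QV _ cQ aQ _ _ (tQP _ _ tab); rewrite !E => -[/piP ? /piP ?].
Qed.

Definition bval (A : Type) (a b : A) (i : bool) : A := if i then b else a.

(** This is theta on binary terms; [diag_eq p (Var false)] says that p is idempotent in the
    variety. *)
Definition diag_eq (S : signature) (Sigma : identities S) (p q : term_alg S bool) : Prop :=
  forall B : algebra S, in_variety Sigma B ->
    forall c : B, eval B p (fun=> c) = eval B q (fun=> c).

Lemma diag_eq_congruence (S : signature) (Sigma : identities S) :
  congruence (@diag_eq S Sigma).
Proof.
split; last by move=> p q r pq qr B BV c; rewrite pq // qr.
split=> [p B|p q pq B BV c|f p q pq B BV c] //; first by rewrite pq.
by rewrite /=; congr interp; apply: functional_extensionality => i; apply: pq.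
Qed.

(* An idempotent p satisfies p(q(a,a),q(b,b)) = p(a,b) and p(q(a,b),q(a,b)) = q(a,b). *)
Lemma idempotent_clique (S : signature) (Sigma : identities S) (A : algebra S)
    (T : A -> A -> Prop) (a b : A) (p q : term_alg S bool) :
  in_variety Sigma A -> tolerance T -> T a b ->
  diag_eq Sigma p (Var false) -> diag_eq Sigma q (Var false) ->
  T (eval A p (bval a b)) (eval A q (bval a b)).
Proof.
move=> AV [Tr Ts Tc] Tab Kp Kq.
rewrite -[X in T _ X]/(eval A (Var false) (fun=> eval A q (bval a b))) -Kp //.
apply: eval_compatible => // i.
have -> : bval a b i = eval A q (fun=> bval a b i) by rewrite Kq.
apply: eval_compatible => // j.
by case: i j => [] [] //=; apply: Ts.
Qed.

(* The largest congruence below [diag_eq] whose restriction to the class of [Var false],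
   i.e. to the idempotent terms, is equality of values at (a,b). *)
Definition idempotent_part_eq (S : signature) (Sigma : identities S) (A : algebra S) (a b : A)
    (p q : term_alg S bool) : Prop :=
  diag_eq Sigma p q /\
  forall g : term S (option (term_alg S bool)),
    diag_eq Sigma (eval (term_alg S bool) g (odflt p)) (Var false) ->
    eval A (eval (term_alg S bool) g (odflt p)) (bval a b) =
    eval A (eval (term_alg S bool) g (odflt q)) (bval a b).

Lemma plug_comp (S : signature) (A : algebra S) (g h : term S (option A)) :
  exists k : term S (option A),
    forall x, eval A k (odflt x) = eval A g (odflt (eval A h (odflt x))).
Proof.
exists (eval (term_alg S (option A)) g (fun o => if o is Some c then Var (Some c) else h)) => y.
by rewrite eval_subst; apply: eval_ext => -[].
Qed.

Lemma plug_compatible (S : signature) (A : algebra S) (R : A -> A -> Prop)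
    (g : term S (option A)) (x y : A) :
  tolerance R -> R x y -> R (eval A g (odflt x)) (eval A g (odflt y)).
Proof. by move=> [Rr _ Rc] Rxy; apply: eval_compatible => // -[]. Qed.

Lemma idempotent_part_eq_congruence (S : signature) (Sigma : identities S) (A : algebra S)
    (a b : A) : congruence (@idempotent_part_eq S Sigma A a b).
Proof.
have [tD Dt] := diag_eq_congruence Sigma; have [Dr Ds Dc] := tD.
have refl p : idempotent_part_eq Sigma a b p p by split.
have trans p q r : idempotent_part_eq Sigma a b p q -> idempotent_part_eq Sigma a b q r ->
    idempotent_part_eq Sigma a b p r.
  move=> [pq Hpq] [qr Hqr]; split=> [|g Kg]; first exact: Dt pq qr.
  rewrite Hpq //; apply: Hqr; apply: (Dt _ _ _ _ Kg).
  exact: Ds (plug_compatible g tD pq).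
split=> //; split=> // [p q [pq Hpq]|].
  split=> [|g Kg]; first exact: Ds.
  by rewrite Hpq //; apply: (Dt _ _ _ _ Kg); apply: (plug_compatible g tD pq).
apply: compatible_of_polynomials => // h p q [pq Hpq]; split; first exact: (plug_compatible h tD pq).
by move=> g; have [k Ek] := plug_comp g h; rewrite -!Ek; apply: Hpq.
Qed.

(** The first argument moves by a true T-step at (a,b), but the parameters are only joined by two,
    from c(a,b) to c(a,a) = d(a,a) to d(a,b). This is the situation of [collapse_two_steps]. *)
Lemma idempotent_part_centralizes_step (S : signature) (Sigma : identities S)
    (A : algebra S) (T : A -> A -> Prop) (a b : A) (m : nat) (t : term S (option 'I_m))
    (u v : term_alg S bool) (c d : 'I_m -> term_alg S bool) :
  has_taylor_term Sigma -> in_variety Sigma A -> tolerance T -> abelian T -> T a b ->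
  diag_eq Sigma u v -> T (eval A u (bval a b)) (eval A v (bval a b)) ->
  (forall i, diag_eq Sigma (c i) (d i)) ->
  idempotent_part_eq Sigma a b (eval (term_alg S bool) t (xval u c))
    (eval (term_alg S bool) t (xval u d)) ->
  idempotent_part_eq Sigma a b (eval (term_alg S bool) t (xval v c))
    (eval (term_alg S bool) t (xval v d)).
Proof.
move=> [n [tau [idem pat]]] AV tT ab Tab uv Tuv cd [_ H].
have [Tr Ts Tc] := tT; have [tD Dt] := diag_eq_congruence Sigma; have [Dr Ds Dc] := tD.
split; first by apply: eval_compatible => // -[i|] /=; [exact: cd | exact: Dr].
move=> g; set N := fun u c => eval (term_alg S bool) g
  (odflt (eval (term_alg S bool) t (@xval (term_alg S bool) m u c))).
rewrite -/(N v c) -/(N v d) => Kvc.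
have {H} : diag_eq Sigma (N u c) (Var false) ->
  eval A (N u c) (bval a b) = eval A (N u d) (bval a b) by exact: H.
have DN u' c' : diag_eq Sigma u' v -> (forall i, diag_eq Sigma (c' i) (c i)) ->
    diag_eq Sigma (N u' c') (Var false).
  move=> u'v c'c; apply: (Dt _ _ _ _ Kvc); apply: (plug_compatible g tD).
  by apply: eval_compatible => // -[].
have Kuc : diag_eq Sigma (N u c) (Var false) by exact: DN.
have Kud : diag_eq Sigma (N u d) (Var false) by apply: DN => // i; apply: Ds.
have Kvd : diag_eq Sigma (N v d) (Var false) by apply: DN => // i; apply: Ds.
move=> /(_ Kuc) Euc.
pose hA x e := eval A g (fun o => if o is Some q then eval A q (bval a b)
  else eval A t (@xval A m x e)).
have EN u' c' : eval A (N u' c') (bval a b) =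
    hA (eval A u' (bval a b)) (fun i => eval A (c' i) (bval a b)).
  rewrite /N eval_subst; apply: eval_ext => -[q|] //=.
  by rewrite eval_subst; apply: eval_ext => -[].
have M x x' e e' : T x x' -> (forall i, T (e i) (e' i)) ->
    Mat T T (hA x e) (hA x' e) (hA x e') (hA x' e').
  move=> Tx Te; apply: Mat_eval => -[q|]; first exact: Mat_left.
  by apply: Mat_eval => -[i|] /=; [apply: Mat_left | apply: Mat_right].
have diagT (q : term_alg S bool) : T (eval A q (bval a b)) (eval A q (fun=> a)).
  by apply: eval_compatible => // -[] //=; apply: Ts.
(* p' and r' are the values at the middle parameters c(a,a); idempotency makes p, r and s pairwise
   T-related. *)
apply: (collapse_two_steps (p := eval A (N u c) (bval a b))
  (p' := hA (eval A u (bval a b)) (fun i => eval A (c i) (fun=> a)))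
  (r' := hA (eval A v (bval a b)) (fun i => eval A (c i) (fun=> a))) tT ab (idem A AV)) => //.
- by move=> i; have [w [z [wz e]]] := pat i; exists w, z; split=> //; exact: e.
- by rewrite !EN; apply: M.
- rewrite Euc !EN; apply: M => // i.
  by rewrite cd //; apply: Ts.
- exact: (idempotent_clique AV).
- exact: (idempotent_clique AV).
- exact: (idempotent_clique AV).
Qed.

Lemma cond1_cond2 (S : signature) (Sigma : identities S) :
  has_taylor_term Sigma -> cond1 Sigma -> cond2 Sigma.
Proof.
move=> tay [w wd]; exists w => A AV T tT ab a b Tab.
have [Tr Ts Tc] := tT; have cD := diag_eq_congruence Sigma.
have [[Dr Ds _] Dt] := cD.
have cI := idempotent_part_eq_congruence Sigma a b; have [[_ Is _] _] := cI.
have ev_w p q r : eval A (eval (term_alg S bool) w (val3 p q r)) (bval a b) =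
    eval A w (val3 (eval A p (bval a b)) (eval A q (bval a b)) (eval A r (bval a b))).
  by rewrite eval_subst; apply: eval_ext => -[[|[|[|]]]].
have use p : idempotent_part_eq Sigma a b p (Var true) -> eval A p (bval a b) = b.
  by move=> /Is [_ /(_ (Var None))] /= <-.
have [||||/use H1 /use H2] := @weak_difference_modulo S Sigma w (term_alg S bool)
    (@diag_eq S Sigma) (@idempotent_part_eq S Sigma A a b) (Var false) (Var true) wd cD cI.
- by move=> x y [].
- move=> l r lr v; split=> [B BV c|g _]; first by rewrite !eval_subst; apply: BV.
  rewrite !eval_subst; apply: eval_ext => -[] //=.
  by rewrite !eval_subst; apply: AV.
- move=> m t u v c d uv cd H.
  (* The term u(x,x) lies in between, as u(a,b) T u(a,a) = v(a,a) T v(a,b), so the step lemma is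
     applied twice. *)
  pose u' : term_alg S bool := eval (term_alg S bool) u (fun=> Var false).
  have uu' : diag_eq Sigma u u' by move=> B BV e; rewrite /u' eval_subst.
  have Eu' : eval A u' (bval a b) = eval A u (fun=> a) by rewrite eval_subst.
  have diagT (q : term_alg S bool) : T (eval A q (bval a b)) (eval A q (fun=> a)).
    by apply: eval_compatible => // -[] //=; apply: Ts.
  apply: (idempotent_part_centralizes_step (T := T) (u := u')) => //.
  + exact: Dt (Ds _ _ uu') uv.
  + by rewrite Eu' uv //; apply: Ts.
  + by apply: (idempotent_part_centralizes_step (T := T) (u := u)) => //; rewrite Eu'.
- by [].
by rewrite !ev_w in H1 H2.
Qed.

(** * Taylor collapses for (4) => (1) *)

(** Entries other than i may be switched freely between r and s. The Taylor identity at i thus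
    equates t(r,...,s,...,r), with s at i, and t(r,...,r), the one condition missing for
    [taylor_collapse]. *)
Lemma taylor_collapse_but_one (S : signature) (A : algebra S) (T : A -> A -> Prop) (n : nat)
    (t : term S 'I_n) (r s : A) (i : 'I_n) (w z : 'I_n -> nat) :
  tolerance T -> abelian T -> (forall a : A, eval A t (fun=> a) = a) -> T r s ->
  w i <> z i ->
  (forall v : nat -> A, eval A t (fun j => v (w j)) = eval A t (fun j => v (z j))) ->
  (forall j, j != i -> exists y : 'I_n -> A, (forall j, T (y j) r /\ T (y j) s) /\
     eval A t (upd y j r) = eval A t (upd y j s)) ->
  r = s.
Proof.
move=> tT ab idem Trs wz pat H; have [Tr Ts _] := tT.
apply: (taylor_collapse tT ab idem Trs) => j.
have [->|/H //] := eqVneq j i; exists (fun=> r); split=> //.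
have reduce c : (forall k, c k = r \/ c k = s) -> eval A t c = eval A t (upd (fun=> r) i (c i)).
  move=> cP; apply: (change_one_by_one (a := c) (b := upd (fun=> r) i (c i))
    (Q := fun e => eval A t c = eval A t e)) => // e k eP ek ->.
  have [ki|ki] := eqVneq k i; first by rewrite {2}/upd ki eqxx -ki -ek upd_id.
  rewrite {2}/upd (negbTE ki); case: (cP k) => ck; first by rewrite -ck -ek upd_id.
  rewrite -{1}(upd_id e k) ek ck; apply/esym.
  have [y [Ty Ey]] := H k ki; apply: (exchange tT ab Trs _ Ey) => l.
  have [? ?] := Ty l; case: (eP l) => ->; last rewrite /upd; last case: eqP => // _.
    by case: (cP l) => ->.
  by case: (cP i) => ->.
pose v m := if m == w i then s else r.
have vP c (k : 'I_n) : v (c k) = r \/ v (c k) = s by rewrite /v; case: eqP; [right | left].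
have := pat v; rewrite (reduce _ (vP w)) (reduce _ (vP z)) /v eqxx.
by case: eqP => [zw|_ ->] //; case: wz.
Qed.

(* In module terms, with t = sum_i t_i x_i: the hypothesis kills all products t_j t_i with
   j <> i, the Taylor identities then kill t_i t_i, so every t_i and hence 1 vanishes. *)
Lemma taylor_products_collapse (S : signature) (A : algebra S) (T : A -> A -> Prop) (n : nat)
    (t : term S 'I_n) (x z u : A) :
  congruence T -> abelian T -> (forall a : A, eval A t (fun=> a) = a) ->
  (forall i, exists w z : 'I_n -> nat, w i <> z i /\
     forall v : nat -> A, eval A t (fun j => v (w j)) = eval A t (fun j => v (z j))) ->
  T x z -> T x u ->
  (forall i j, j != i ->
     eval A t (upd (upd (fun=> x) i u) j (eval A t (upd (fun=> x) i z))) =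
     eval A t (upd (fun=> x) i u)) ->
  x = z.
Proof.
move=> [tT Tt] ab idem pat Txz Txu H; have [Tr Ts Tc] := tT.
apply: (taylor_collapse tT ab idem Txz) => i.
exists (fun=> x); split=> //; rewrite upd_const idem.
have Txg : T x (eval A t (upd (fun=> x) i z)).
  rewrite -{1}(idem x); apply: eval_compatible => // k.
  by rewrite /upd; case: eqP.
(* What is left at entry i is itself a collapse, of x and t(x,...,z,...,x); the hypothesis on
   products covers its entries j <> i. *)
have [w [w' [ww' e]]] := pat i.
apply: (taylor_collapse_but_one tT ab idem Txg ww' e) => j ne.
exists (upd (fun=> x) i u); split; last by rewrite H // upd_upd_const.
move=> k; rewrite /upd; case: eqP => // _; split; first exact: Ts.
exact: Tt (Ts _ _ Txu) Txg.
Qed.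

(** * Gluing in the algebra F *)

(** Comparing terms at all such pairs at once plays the part of one generic pair in an abelian
    congruence. *)
Definition abelian_pair (S : signature) (Sigma : identities S) (B : algebra S)
    (beta : B -> B -> Prop) (a b : B) : Prop :=
  [/\ in_variety Sigma B, congruence beta, abelian beta & beta a b].

Definition left_difference (S : signature) (Sigma : identities S) (t : term S 'I_3) : Prop :=
  forall (B : algebra S) (beta : B -> B -> Prop) (a b : B),
    abelian_pair Sigma beta a b -> eval B t (val3 a a b) = b.

Lemma abelian_pair_left (S : signature) (Sigma : identities S) (B : algebra S)
    (beta : B -> B -> Prop) (a b c : B) :
  abelian_pair Sigma beta a b -> beta a c -> abelian_pair Sigma beta a c.
Proof. by case=> BV cb ab _; split. Qed.

Lemma abelian_pair_sym (S : signature) (Sigma : identities S) (B : algebra S)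
    (beta : B -> B -> Prop) (a b : B) :
  abelian_pair Sigma beta a b -> abelian_pair Sigma beta b a.
Proof. by case=> BV cb ab bab; split=> //; case: cb => -[_ bs _] _; apply: bs. Qed.

Definition var3 (S : signature) (i : 'I_3) : term S 'I_3 := Var i.

Lemma eval_val3 (S : signature) (B : algebra S) (X : Type) (t : term S 'I_3)
    (p q r : term S X) (v : X -> B) :
  eval B (eval (term_alg S X) t (val3 p q r)) v =
  eval B t (val3 (eval B p v) (eval B q v) (eval B r v)).
Proof. by rewrite eval_subst; apply: eval_ext => -[[|[|[|]]]]. Qed.

(** With f = t(b,a,e), replacing the first b by a in t(b,b,f) = t(b,a,e) gives t(a,b,f) = t(a,a,e) =
    e. This inverse makes [shifted] symmetric over v. *)
Lemma left_differenceK (S : signature) (Sigma : identities S) (t : term S 'I_3)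
    (B : algebra S) (beta : B -> B -> Prop) (a b e : B) :
  left_difference Sigma t -> abelian_pair Sigma beta a b -> beta a e ->
  eval B t (val3 a b (eval B t (val3 b a e))) = e.
Proof.
move=> Lt ab_pair ae; have [BV [[br bs bc] bt] ab bab] := ab_pair.
have ev_e : beta b (eval B t (val3 b a e)).
  rewrite -{1}(Lt _ _ _ _ (abelian_pair_left (abelian_pair_sym ab_pair) (br b))).
  apply: eval_compatible => // -[[|[|[|]]] // i3]; rewrite /val3 /=; first exact: bs.
  exact: bt (bs _ _ bab) ae.
have Lb := Lt _ _ _ _ (abelian_pair_left (abelian_pair_sym ab_pair) ev_e).
rewrite -[RHS](Lt _ _ _ _ (abelian_pair_left ab_pair ae)).
apply: (centralizes_Mat br ab _ Lb); apply: Mat_eval => -[[|[|[|]]] // i3]; rewrite /val3 /=.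
- by apply: Mat_left; apply: bs.
- by apply: Mat_right; apply: bs.
- by apply: Mat_right; exact: bt (bs _ _ ev_e) (bt _ _ _ (bs _ _ bab) ae).
Qed.

(* The generators (x,u), (z,u), (x,v), (z,v) are the pairs of booleans: the first entry
   selects x or z, the second one u or v. *)
Definition val_fst (B : Type) (a b : B) (x : bool * bool) : B := bval a b x.1.
Definition val_snd (B : Type) (a b : B) (x : bool * bool) : B := bval a b x.2.

Definition snd_eq (S : signature) (Sigma : identities S) (p q : term_alg S (bool * bool)) : Prop :=
  forall (B : algebra S) (beta : B -> B -> Prop) (a b : B), abelian_pair Sigma beta a b ->
    eval B p (val_snd a b) = eval B q (val_snd a b).

Definition shifted (S : signature) (Sigma : identities S) (p q : term_alg S (bool * bool)) : Prop :=
  exists2 t, left_difference Sigma t &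
    forall (B : algebra S) (beta : B -> B -> Prop) (a b : B), abelian_pair Sigma beta a b ->
      eval B q (val_fst a b) = eval B t (val3 b a (eval B p (val_fst a b))).

(** The largest congruence inside [snd_eq] that is contained in [shifted] on the terms with second
    coordinate v. *)
Definition glue (S : signature) (Sigma : identities S) (p q : term_alg S (bool * bool)) : Prop :=
  snd_eq Sigma p q /\
  forall g : term S (option (term_alg S (bool * bool))),
    snd_eq Sigma (eval (term_alg S (bool * bool)) g (odflt p)) (Var (true, true)) ->
    shifted Sigma (eval (term_alg S (bool * bool)) g (odflt p))
      (eval (term_alg S (bool * bool)) g (odflt q)).

Lemma snd_eq_congruence (S : signature) (Sigma : identities S) : congruence (@snd_eq S Sigma).
Proof.
split; last by move=> p q r pq qr B beta a b h; rewrite (pq _ _ _ _ h) (qr _ _ _ _ h).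
split=> [p B|p q pq B beta a b h|f p q pq B beta a b h] //; first by rewrite (pq _ _ _ _ h).
by rewrite /=; congr interp; apply: functional_extensionality => i; apply: pq h.
Qed.

Lemma fst_snd_related (S : signature) (Sigma : identities S) (B : algebra S)
    (beta : B -> B -> Prop) (a b : B) (p : term S (bool * bool)) :
  abelian_pair Sigma beta a b ->
  beta (eval B p (val_fst a b)) (eval B p (val_snd a b)).
Proof.
move=> [_ [[br bs bc] _] _ bab]; apply: eval_compatible => // -[[] []] //=.
exact: bs.
Qed.

Lemma shifted_of_fst_eq (S : signature) (Sigma : identities S) (p q : term_alg S (bool * bool)) :
  (forall (B : algebra S) (beta : B -> B -> Prop) (a b : B), abelian_pair Sigma beta a b ->
    eval B p (val_fst a b) = eval B q (val_fst a b)) ->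
  shifted Sigma p q.
Proof. by move=> pq; exists (Var ord_max) => // B beta a b /pq /= ->. Qed.

Lemma shifted_sym (S : signature) (Sigma : identities S) (p q : term_alg S (bool * bool)) :
  snd_eq Sigma p (Var (true, true)) -> shifted Sigma p q -> shifted Sigma q p.
Proof.
move=> p2 [t Lt tE].
exists (eval (term_alg S 'I_3) t
  (val3 (var3 S (@Ordinal 3 1 isT)) (var3 S ord0) (var3 S ord_max))) => B beta a b h.
  by rewrite eval_val3; apply: Lt h.
rewrite eval_val3 (tE _ _ _ _ h); apply/esym/(left_differenceK Lt h).
have [_ [[_ bs _] bt] _ bab] := h.
have pb : eval B p (val_snd a b) = b := p2 _ _ _ _ h.
by apply: (bt _ _ _ bab); apply: bs; rewrite -[X in beta _ X]pb; exact: fst_snd_related h.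
Qed.

Lemma shifted_trans (S : signature) (Sigma : identities S) (p q r : term_alg S (bool * bool)) :
  shifted Sigma p q -> shifted Sigma q r -> shifted Sigma p r.
Proof.
move=> [t Lt tE] [t' Lt' tE'].
exists (eval (term_alg S 'I_3) t'
  (val3 (var3 S ord0) (var3 S (@Ordinal 3 1 isT)) t)) => B beta a b h.
  rewrite eval_val3 /= (_ : eval B t _ = b); first exact: Lt' h.
  exact: Lt h.
by rewrite eval_val3 (tE' _ _ _ _ h) (tE _ _ _ _ h).
Qed.

Lemma glue_congruence (S : signature) (Sigma : identities S) : congruence (@glue S Sigma).
Proof.
have [tE Et] := snd_eq_congruence Sigma; have [Er Es Ec] := tE.
have move_snd g p q : snd_eq Sigma p q ->
    snd_eq Sigma (eval (term_alg S (bool * bool)) g (odflt p)) (Var (true, true)) ->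
    snd_eq Sigma (eval (term_alg S (bool * bool)) g (odflt q)) (Var (true, true)).
  move=> pq gp; apply: (Et _ _ _ _ gp); exact: Es (plug_compatible g tE pq).
have refl p : glue Sigma p p by split=> // g _; exact: shifted_of_fst_eq.
have trans p q r : glue Sigma p q -> glue Sigma q r -> glue Sigma p r.
  move=> [pq Hpq] [qr Hqr]; split=> [|g gp]; first exact: Et pq qr.
  by apply: shifted_trans (Hpq g gp) _; apply: Hqr; apply: move_snd gp.
split=> //; split=> // [p q [pq Hpq]|].
  split=> [|g gq]; first exact: Es.
  have gp := move_snd g _ _ (Es _ _ pq) gq.
  by apply: shifted_sym => //; apply: Hpq.
apply: compatible_of_polynomials => // h p q [pq Hpq]; split; first exact: (plug_compatible h tE pq).
by move=> g; have [k Ek] := plug_comp g h; rewrite -!Ek; apply: Hpq.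
Qed.

(** Terms stand for elements of F, so those with the same two coordinates are identified; the shift
    is the third projection. *)
Lemma glue_of_eq (S : signature) (Sigma : identities S) (p q : term_alg S (bool * bool)) :
  (forall (B : algebra S) (beta : B -> B -> Prop) (a b : B), abelian_pair Sigma beta a b ->
    eval B p (val_fst a b) = eval B q (val_fst a b)) ->
  snd_eq Sigma p q -> glue Sigma p q.
Proof.
move=> pq1 pq2; split=> // g _; apply: shifted_of_fst_eq => B beta a b h.
by rewrite !eval_subst; apply: eval_ext => -[] //=; apply: pq1 h.
Qed.

Lemma glue_generators (S : signature) (Sigma : identities S) :
  glue Sigma (Var (false, false)) (Var (true, false)).
Proof.
split=> // g gb.
(* The hole of [g] becomes the first variable; parameters are read in their second coordinate, with
   u and v as the other two. As g(x,u) lies over v, t(a,a,b) = b. *)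
pose t := eval (term_alg S 'I_3) g (fun o => if o is Some c
  then eval (term_alg S 'I_3) c (val_snd (var3 S (@Ordinal 3 1 isT)) (var3 S ord_max))
  else var3 S ord0).
have Et (B : algebra S) (x y z : B) : eval B t (val3 x y z) =
    eval B g (fun o => if o is Some c then eval B c (val_snd y z) else x).
  rewrite eval_subst; apply: eval_ext => -[c|] //.
  by rewrite eval_subst; apply: eval_ext => -[i []].
have Lt : left_difference Sigma t.
  move=> B beta a b h; have gb2 : _ = b := gb _ _ _ _ h; rewrite Et -[RHS]gb2 eval_subst.
  by apply: eval_ext => -[].
exists t => // B beta a b h; set e := (X in val3 b a X).
have [BV [[br bs bc] bt] ab bab] := h.
have bae : beta a e.
  have gb2 : _ = b := gb _ _ _ _ h.
  by apply: (bt _ _ _ bab); apply: bs; rewrite -[X in beta _ X]gb2; exact: fst_snd_related h.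
have bb c : beta (eval B c (val_snd a e)) (eval B c (val_fst a b)).
  apply: eval_compatible => // -[[] []]; rewrite /val_snd /val_fst /= //.
  - exact: bt (bs _ _ bae) bab.
  - exact: bs.
have E x : eval B (eval (term_alg S (bool * bool)) g (odflt x)) (val_fst a b) =
    eval B g (fun o => if o is Some c then eval B c (val_fst a b) else eval B x (val_fst a b)).
  by rewrite eval_subst; apply: eval_ext => -[].
(* By t(a,a,e) = e, with a in the hole, reading the parameters at (u,v) = (a,e) or in their first
   coordinate gives the same value. The term condition then puts b in the hole. *)
have He : eval B g (fun o => if o is Some c then eval B c (val_snd a e) else a) =
    eval B g (fun o => if o is Some c then eval B c (val_fst a b) else a).
  by rewrite -Et (Lt _ _ _ _ (abelian_pair_left h bae)) /e E.
rewrite Et E; apply: esym; apply: (centralizes_Mat br ab _ He); apply: Mat_eval => -[c|].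
- exact: Mat_right.
- exact: Mat_left.
Qed.

(** * From (4) to (1) *)

Lemma cond4_cond1 (S : signature) (Sigma : identities S) :
  has_taylor_term Sigma -> cond4 Sigma -> cond1 Sigma.
Proof.
move=> [n [tau [idem pat]]] c4; pose P := term_alg S (bool * bool).
have [E [pi [pi_hom piP pi_surj]]] := quotient_exists (glue_congruence Sigma).
have EV : in_variety Sigma E.
  apply: (quotient_in_variety pi_hom pi_surj) => l r lr v; apply/piP.
  by apply: glue_of_eq => B beta a b [BV _ _ _]; rewrite !eval_subst; apply: BV.
have eval_pi X (t : term S X) v : eval E t (fun x => pi (v x)) = pi (eval P t v).
  exact: eval_hom.
pose rel (p q : P) := forall (B : algebra S) (beta : B -> B -> Prop) (a b : B),
  abelian_pair Sigma beta a b -> eval B p (val_fst a b) = eval B q (val_fst a b) /\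
  beta (eval B p (val_snd a b)) (eval B q (val_snd a b)).
pose T x y := exists p : P * P, [/\ pi p.1 = x, pi p.2 = y & rel p.1 p.2].
have tT : tolerance T.
  split=> [x|x y [[p q] /= [px qy pq]]|f x y xy].
  - have [p <-] := pi_surj x; exists (p, p); split=> // B beta a b [_ [[br _ _] _] _ _].
    by split.
  - exists (q, p); split=> // B beta a b h; have [e1 e2] := pq _ _ _ _ h.
    by split; [rewrite e1 | case: h => _ [[_ bs _] _] _ _; apply: bs].
  have [F HF] := functional_choice _ xy.
  exists (@interp S P f (fun i => (F i).1), @interp S P f (fun i => (F i).2)).
  rewrite /= !pi_hom; split.
  - by congr interp; apply: functional_extensionality => i; case: (HF i).
  - by congr interp; apply: functional_extensionality => i; case: (HF i).
  move=> B beta a b h; split=> /=.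
    congr interp; apply: functional_extensionality => i.
    by case: (HF i) => _ _ /(_ _ _ _ _ h) [].
  have [_ [[_ _ bc] _] _ _] := h; apply: bc => i.
  by case: (HF i) => _ _ /(_ _ _ _ _ h) [].
(* Equality in the quotient implies equal second coordinates, to which the term condition of beta
   applies. First coordinates agree because those of c and d do. *)
have aT : abelian T.
  move=> m t x y c d [[p q] /= [<- <- pq]] cd.
  have [F HF] := functional_choice _ cd.
  have -> : c = (fun i => pi (F i).1) by apply: functional_extensionality => i; case: (HF i).
  have -> : d = (fun i => pi (F i).2) by apply: functional_extensionality => i; case: (HF i).
  have Ex u (e : 'I_m -> P) : xval (pi u) (fun i => pi (e i)) = (fun o => pi (xval u e o)).
    by apply: functional_extensionality => -[].
  have relF i : rel (F i).1 (F i).2 by case: (HF i).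
  rewrite !Ex !eval_pi => /piP [H _]; apply/piP; apply: glue_of_eq => B beta a b h.
    rewrite !eval_subst; apply: eval_ext => -[i|] //=.
    by case: (relF i _ _ _ _ h).
  have Es u (e : 'I_m -> P) : eval B (eval P t (xval u e)) (val_snd a b) =
      eval B t (xval (eval B u (val_snd a b)) (fun i => eval B (e i) (val_snd a b))).
    by rewrite eval_subst; apply: eval_ext => -[].
  have := H _ _ _ _ h; rewrite !Es; have [_ _ ab _] := h; apply: ab.
    by case: (pq _ _ _ _ h).
  by move=> i; case: (relF i _ _ _ _ h).
have aC := c4 _ EV _ tT aT.
have cC : congruence (Cg T).
  split; last by move=> x y z xy yz th cth sub; case: (cth) => _; apply; [apply: xy | apply: yz].
  split=> [x th [[r _ _] _] _|x y xy th cth sub|f x y xy th cth sub]; first exact: r.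
    by case: (cth) => -[_ s _] _; apply: s; apply: xy.
  by case: (cth) => -[_ _ c] _; apply: c => i; apply: xy.
have subC x y : T x y -> Cg T x y by move=> xy th _; apply.
pose gen i j : P := Var (i, j).
have zuxu : pi (gen true false) = pi (gen false false).
  by apply/esym/piP; exact: glue_generators.
have vert i : Cg T (pi (gen i true)) (pi (gen i false)).
  apply: subC; exists (gen i true, gen i false); split=> // B beta a b [_ [[_ bs _] _] _ bab].
  by split=> //; apply: bs.
have [[_ Cs _] Ct] := cC.
(* Over v gluing is a shift, so this equality yields t with b = t(b,a,a), the other half of a weak
   difference term. *)
suff /piP [_ /(_ (Var None))] : pi (gen false true) = pi (gen true true).
  case=> // t Lt Et; exists t => B BV beta cb ab a b bab.
  have h : abelian_pair Sigma beta a b by [].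
  by split; [apply: Lt h | apply/esym; apply: Et h].
apply: (taylor_products_collapse (u := pi (gen false false)) cC aC (idem E EV)).
- by move=> i; have [w [z [wz e]]] := pat i; exists w, z; split=> //; exact: e.
(* The path is (x,v) T (x,u) = (z,u) T (z,v). *)
- by apply: (Ct _ _ _ (vert false)); rewrite -zuxu; apply: Cs.
- exact: vert.
move=> i j ne.
pose p := eval P tau (upd (fun=> gen false true) i (gen false false)).
pose q := eval P tau (upd (fun=> gen false true) i (gen true false)).
pose g := eval P tau (upd (fun=> gen false true) i (gen true true)).
have pE : eval E tau (upd (fun=> pi (gen false true)) i (pi (gen false false))) = pi p.
  by rewrite -eval_pi fun_upd.
have qE : pi q = pi p by rewrite -pE -zuxu -eval_pi fun_upd.
have gE : eval E tau (upd (fun=> pi (gen false true)) i (pi (gen true true))) = pi g.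
  by rewrite -eval_pi fun_upd.
(* As p = q in the quotient, the right side is t(p,...,q,...,p) with q at j. Both sides now agree
   already in F: first coordinates are x off j and t(x,...,z,...,x) at j, and both second
   coordinates are t(v,...,u,...,v). *)
rewrite pE gE -[RHS](idem E EV) -(upd_const j (pi p)) -{2}qE.
rewrite -(fun_upd pi (fun=> p)) -(fun_upd pi (fun=> gen false true)) -fun_upd !eval_pi.
apply/piP; apply: glue_of_eq => B beta a b [BV _ _ _].
  rewrite !eval_subst_upd (fun_upd (fun t => eval B t (val_fst a b))) /val_fst /=.
  by rewrite !upd_const (idem B BV).
rewrite !eval_subst_upd (fun_upd (fun t => eval B t (val_snd a b))) /val_snd /=.
by rewrite !upd_const !(idem B BV) upd_upd_const.
Qed.

Theorem theorem3p1 (S : signature) (Sigma : identities S) :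
  has_taylor_term Sigma ->
  [/\ cond1 Sigma <-> cond2 Sigma,
      cond1 Sigma <-> cond3 Sigma &
      cond1 Sigma <-> cond4 Sigma].
Proof.
move=> tay.
have c12 : cond1 Sigma -> cond2 Sigma := cond1_cond2 tay.
have c23 : cond2 Sigma -> cond3 Sigma.
  move=> [w Hw] A AV T tT ab; split=> // x y z xy yz; have [Tr Ts Tc] := tT.
  have [_ <-] := Hw _ AV _ tT ab _ _ (Ts _ _ xy).
  have [<- _] := Hw _ AV _ tT ab _ _ yz.
  by apply: eval_compatible => // -[[|[|[|]]] // i3]; rewrite /val3.
have c34 : cond3 Sigma -> cond4 Sigma.
  move=> H A AV T tT ab; have cT := H _ AV _ tT ab.
  have CgT x y : Cg T x y -> T x y by apply.
  by move=> n t x y c d /CgT xy cd; apply: ab => // i; apply: CgT.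
have c41 : cond4 Sigma -> cond1 Sigma := cond4_cond1 tay.
by split; split=> ?; auto.
Qed.
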